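(* A finite simple graph $G$ is isomorphic to $S\Omega(\Gamma)$ for some finite simple graph $\Gamma$ if and only if $G$ has no two adjacent vertices that are structurally equivalent.
   Context: Two vertices $u,v$ of a graph $G$ are structurally equivalent if the transposition $(u\,v)$ (swapping $u,v$, fixing other vertices) is an automorphism of $G$. For a graph $\Gamma$, consider partitions of $V(\Gamma)$ into nonempty parts such that each part induces a complete subgraph and, for any two distinct parts $P,Q$, either every vertex of $P$ is adjacent to every vertex of $Q$ or no vertex of $P$ is adjacent to any vertex of $Q$. The complete skeleton $\Omega(\Gamma)$ is such a partition with the minimum number of parts; its structure $S\Omega(\Gamma)$ is the simple graph whose vertices are the parts, two parts being adjacent iff they are completely joined. *)

(* Defs.v *)
From HB Require Import structures.
From mathcomp Require Import all_boot perm.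

Set Implicit Arguments.
Unset Strict Implicit.
Unset Printing Implicit Defensive.

Record sgraph := SGraph {
  vertex :> finType;
  adj : rel vertex;
  adj_sym : symmetric adj;
  adj_irrefl : irreflexive adj }.

Definition isomorphic (G H : sgraph) : Prop :=
  exists2 f : G -> H, bijective f & forall x y, adj (f x) (f y) = adj x y.

Definition automorphism (G : sgraph) (s : {perm G}) : Prop :=
  forall x y, adj (s x) (s y) = adj x y.

Definition structurally_equivalent (G : sgraph) (u v : G) : Prop :=
  automorphism (tperm u v).

Section Skeleton.
Variable Gamma : sgraph.
Implicit Types (A B : {set Gamma}) (P : {set {set Gamma}}).

Definition complete A : bool :=
  [forall x in A, forall y in A, (x != y) ==> adj x y].

Definition joined A B : bool := [forall x in A, forall y in B, adj x y].

Definition unjoined A B : bool := [forall x in A, forall y in B, ~~ adj x y].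

Definition skeleton_partition P : bool :=
  [&& partition P [set: Gamma],
      [forall A in P, complete A]
    & [forall A in P, forall B in P, (A != B) ==> joined A B || unjoined A B]].

Definition singletons : {set {set Gamma}} := [set [set x] | x : Gamma].

(* The partition into singletons, always admissible by singletons_skeleton,
   is only the starting point of the minimization. The minimizer is unique:
   see complete_skeletonP and complete_skeleton_unique. *)
Definition complete_skeleton : {set {set Gamma}} :=
  [arg min_(P < singletons | skeleton_partition P) #|P|].

Lemma singletons_skeleton : skeleton_partition singletons.
Proof.
apply/and3P; split.
- apply/and3P; split.
  + apply/eqP/setP=> x; rewrite inE; apply/bigcupP.
    by exists [set x]; rewrite ?inE // imset_f.
  + apply/trivIsetP=> _ _ /imsetP[x _ ->] /imsetP[y _ ->] neq_xy.
    by rewrite disjoints1 inE; apply: contraNN neq_xy => /eqP->.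
  + by apply/negP=> /imsetP[x _ /setP/(_ x)]; rewrite !inE eqxx.
- apply/forall_inP=> _ /imsetP[x _ ->].
  apply/forall_inP=> y /set1P->; apply/forall_inP=> z /set1P->.
  by rewrite eqxx.
- apply/forall_inP=> _ /imsetP[x _ ->]; apply/forall_inP=> _ /imsetP[y _ ->].
  apply/implyP=> _; case exy: (adj x y); apply/orP; [left|right];
    by apply/forall_inP=> a /set1P->; apply/forall_inP=> b /set1P->; rewrite exy.
Qed.

Lemma complete_skeletonP :
  skeleton_partition complete_skeleton
  /\ forall P, skeleton_partition P -> #|complete_skeleton| <= #|P|.
Proof.
by rewrite /complete_skeleton; case: arg_minnP => //; apply: singletons_skeleton.
Qed.

Definition closed_twin : rel Gamma := fun x y =>
  [forall z, ((z == x) || adj x z) == ((z == y) || adj y z)].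

Lemma closed_twin_eqv : {in [set: Gamma] & &, equivalence_rel closed_twin}.
Proof.
move=> x y z _ _ _; split; first by apply/forallP=> t.
move/forallP=> Exy; apply: eq_forallb => t; by rewrite (eqP (Exy t)).
Qed.

Definition twin_classes := equivalence_partition closed_twin [set: Gamma].

Lemma closed_twin_adj x y z :
  closed_twin x y -> z != x -> z != y -> adj x z = adj y z.
Proof.
by move=> /forallP/(_ z)/eqP Exy /negPf nzx /negPf nzy; move: Exy; rewrite nzx nzy.
Qed.

Lemma mem_twin_classes A x y :
  A \in twin_classes -> x \in A -> (y \in A) = closed_twin x y.
Proof.
case/imsetP=> r _ ->; rewrite !inE /= => rx.
by rewrite (snd (closed_twin_eqv (in_setT r) (in_setT x) (in_setT y)) rx).
Qed.

Lemma twin_classes_skeleton : skeleton_partition twin_classes.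
Proof.
have partT : partition twin_classes [set: Gamma].
  exact: equivalence_partitionP closed_twin_eqv.
apply/and3P; split=> //.
  apply/forall_inP=> A TA; apply/forall_inP=> x xA; apply/forall_inP=> y yA.
  apply/implyP=> neq_xy; move: yA; rewrite (mem_twin_classes _ TA xA).
  by move=> /forallP/(_ x)/eqP; rewrite eqxx (negPf neq_xy) /= adj_sym => <-.
apply/forall_inP=> A TA; apply/forall_inP=> B TB; apply/implyP=> neqAB.
have /trivIsetP/(_ A B TA TB neqAB) disAB : trivIset twin_classes.
  by case/and3P: partT.
have nAB x y : x \in A -> y \in B -> x != y.
  move=> xA yB; apply: contraTneq yB => <-.
  by rewrite (disjointFr disAB xA).
have adjE a b x y : a \in A -> b \in B -> x \in A -> y \in B ->
    adj a b = adj x y.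
  move=> aA bB xA yB; rewrite (@closed_twin_adj a x b) //; last first.
  - by rewrite eq_sym nAB.
  - by rewrite eq_sym nAB.
  - by rewrite -(mem_twin_classes _ TA aA).
  rewrite adj_sym (@closed_twin_adj b y x) ?nAB // 1?adj_sym //.
  by rewrite -(mem_twin_classes _ TB bB).
case: (boolP (joined A B)) => //= /forall_inPn[a aA /forall_inPn[b bB nab]].
apply/forall_inP=> x xA; apply/forall_inP=> y yB.
by rewrite -(adjE a b x y).
Qed.

Lemma skeleton_part_twin P A x y :
  skeleton_partition P -> A \in P -> x \in A -> y \in A -> closed_twin x y.
Proof.
case/and3P=> /and3P[/eqP covP _ _] /forall_inP cP /forall_inP hP PA xA yA.
have /forall_inP cA := cP A PA.
apply/forallP=> z; apply/eqP.
have zc : z \in cover P by rewrite covP inE.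
have [B PB zB] := bigcupP zc.
have adjA u v : u \in A -> v \in A -> (v == u) || adj u v.
  move=> uA vA; have /forall_inP/(_ v vA)/implyP H := cA u uA.
  by have [//|ne] := eqVneq v u; rewrite H // eq_sym.
case: (boolP (z \in A)) => zA; first by rewrite !adjA.
have neqAB : A != B by apply: contraNneq zA => ->.
have nz u : u \in A -> (z == u) = false.
  by move=> uA; apply: contraNF zA => /eqP->.
rewrite !nz //=.
have /forall_inP/(_ B PB)/implyP/(_ neqAB) := hP A PA.
case/orP=> /forall_inP H.
  by rewrite (forall_inP (H x xA)) ?(forall_inP (H y yA)).
by rewrite (negPf (forall_inP (H x xA) z zB)) (negPf (forall_inP (H y yA) z zB)).
Qed.

Lemma complete_skeleton_unique P :
  skeleton_partition P ->
  (forall Q, skeleton_partition Q -> #|P| <= #|Q|) ->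
  P = complete_skeleton.
Proof.
have minE Q : skeleton_partition Q ->
    (forall Q', skeleton_partition Q' -> #|Q| <= #|Q'|) -> Q = twin_classes.
  move=> sQ minQ.
  have [/and3P[/eqP covQ tiQ nQ0] _ _] := and3P sQ.
  have [/and3P[/eqP covT tiT nT0] _ _] := and3P twin_classes_skeleton.
  have inQ (x : Gamma) : x \in cover Q by rewrite covQ inE.
  have inT (x : Gamma) : x \in cover twin_classes by rewrite covT inE.
  pose h (A : {set Gamma}) :=
    odflt set0 (omap (pblock twin_classes) [pick x in A]).
  have hE A x : A \in Q -> x \in A -> h A = pblock twin_classes x.
    move=> QA xA; rewrite /h; case: pickP => [y yA|/(_ x)]; last by rewrite xA.
    apply/eqP; rewrite /= eq_pblock //.
    rewrite (@mem_twin_classes _ y _ (pblock_mem (inT y))) ?mem_pblock //.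
    exact: (skeleton_part_twin sQ QA).
  have hQ : h @: Q = twin_classes.
    apply/setP=> B; apply/imsetP/idP=> [[A QA ->]|TB].
      have [E|[x xA]] := set_0Vmem A; first by rewrite -E QA in nQ0.
      by rewrite (hE A x) // pblock_mem.
    have [E|[x xB]] := set_0Vmem B; first by rewrite -E TB in nT0.
    exists (pblock Q x); first exact: pblock_mem.
    by rewrite (hE _ x) ?pblock_mem ?mem_pblock // (def_pblock tiT TB xB).
  have injh : {in Q &, injective h}.
    apply/imset_injP; rewrite eqn_leq leq_imset_card hQ minQ //.
    exact: twin_classes_skeleton.
  have hid A : A \in Q -> h A = A.
    move=> QA; have [E|[x xA]] := set_0Vmem A; first by rewrite -E QA in nQ0.
    rewrite (hE A x) //; apply/setP=> y; apply/idP/idP=> yA; last first.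
      rewrite (@mem_twin_classes _ x _ (pblock_mem (inT x))) ?mem_pblock //.
      exact: (skeleton_part_twin sQ QA).
    rewrite -(injh (pblock Q y) A) ?mem_pblock ?pblock_mem //.
    rewrite (hE A x) // (hE _ y) ?mem_pblock ?pblock_mem //.
    by apply/eqP; rewrite eq_sym eq_pblock.
  rewrite -hQ; apply/setP=> A; apply/idP/imsetP=> [QA|[B QB ->]].
    by exists A; rewrite ?hid.
  by rewrite hid.
move=> sP minP; have [sS minS] := complete_skeletonP.
by rewrite (minE P) // (minE complete_skeleton).
Qed.

Definition part : finType := {A : {set Gamma} | A \in complete_skeleton}.

Definition part_adj : rel part := fun A B : part =>
  (A != B) && joined (val A) (val B).

Lemma part_adj_sym : symmetric part_adj.
Proof.
have joinedC A B : joined A B -> joined B A.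
  move=> /forall_inP jAB; apply/forall_inP=> y yB; apply/forall_inP=> x xA.
  by rewrite adj_sym (forall_inP (jAB x xA)).
by move=> A B; rewrite /part_adj eq_sym; congr (_ && _); apply/idP/idP; apply: joinedC.
Qed.

Lemma part_adj_irrefl : irreflexive part_adj.
Proof. by move=> A; rewrite /part_adj eqxx. Qed.

Definition skeleton_structure : sgraph := SGraph part_adj_sym part_adj_irrefl.

End Skeleton.

(* Main.v *)
Require Import Defs.
From HB Require Import structures.
From mathcomp Require Import all_boot perm.

Set Implicit Arguments.
Unset Strict Implicit.
Unset Printing Implicit Defensive.

(** The complete skeleton is the partition into classes of closed twins
    (vertices with the same closed neighbourhood), and two adjacent vertices
    are structurally equivalent iff they are distinct closed twins. If two
    adjacent parts are structurally equivalent in the structure graph, then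
    their vertices are closed twins, so the parts coincide. Conversely, if no
    two adjacent vertices of [G] are structurally equivalent, then [G] has no
    distinct closed twins, all the parts of its complete skeleton are
    singletons, and [Gamma := G] works. *)

Section CompleteSkeleton.
Variable Gamma : sgraph.
Implicit Types (A B : {set Gamma}) (P : {set {set Gamma}}).

(** Each part of an admissible partition lies in a single twin class, so no admissible partition has
    fewer parts than there are twin classes; uniqueness of the minimizer concludes. *)
Lemma complete_skeleton_twin_classes :
  complete_skeleton Gamma = twin_classes Gamma.
Proof.
symmetry; apply: complete_skeleton_unique => [|P sP].
  exact: twin_classes_skeleton.
have [/and3P[/eqP covP _ _] _ _] := and3P sP.
(* For a part [A] of [P] this is the twin class containing [A]. Every class [B] is the saturation of
   the part through any of its vertices, so there are at most [#|P|] classes. *)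
pose saturation A := [set y : Gamma | [exists x in A, closed_twin x y]].
apply: leq_trans (leq_imset_card saturation (mem P)).
apply/subset_leq_card/subsetP=> B TB; apply/imsetP.
have [/and3P[_ _ T0] _ _] := and3P (twin_classes_skeleton Gamma).
have [E|[x xB]] := set_0Vmem B; first by rewrite -E TB in T0.
have xP : x \in cover P by rewrite covP inE.
have [A PA xA] := bigcupP xP; exists A => //.
apply/setP=> y; rewrite inE (mem_twin_classes _ TB xB).
apply/idP/existsP=> [xy|[z /andP[zA zy]]]; first by exists x; rewrite xA.
have [_ /(_ (skeleton_part_twin sP PA zA xA)) <-] :=
  closed_twin_eqv (in_setT z) (in_setT x) (in_setT y).
exact: zy.
Qed.

Lemma adj_part_adj (A B : skeleton_structure Gamma) (x y : Gamma) :
  A != B -> x \in val A -> y \in val B -> adj x y = adj A B.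
Proof.
move=> neqAB xA yB; rewrite /= /part_adj neqAB /=.
have [/and3P[_ _ /forall_inP hS] _] := complete_skeletonP Gamma.
have /forall_inP/(_ _ (valP B))/implyP/(_ neqAB) := hS _ (valP A).
case: (boolP (joined _ _)) => [/forall_inP jAB _|_ /= /forall_inP uAB].
  exact: (forall_inP (jAB x xA)).
exact: negPf (forall_inP (uAB x xA) y yB).
Qed.

Lemma part_non_empty (A : skeleton_structure Gamma) : {x | x \in val A}.
Proof.
have [/and3P[/and3P[_ _ S0] _ _] _] := complete_skeletonP Gamma.
have [E|[x xA]] := set_0Vmem (val A); last by exists x.
by have := valP A; rewrite E (negPf S0).
Qed.

Lemma exists_part (x : Gamma) :
  exists A : skeleton_structure Gamma, x \in val A.
Proof.
have [/and3P[/and3P[/eqP covS _ _] _ _] _] := complete_skeletonP Gamma.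
have xS : x \in cover (complete_skeleton Gamma) by rewrite covS inE.
by have [A SA xA] := bigcupP xS; exists (Sub A SA).
Qed.

(** Minimality of the skeleton enters here: an admissible partition may separate twins, a minimal
    one cannot. *)
Lemma part_eqP (A B : skeleton_structure Gamma) (x y : Gamma) :
  x \in val A -> y \in val B -> reflect (A = B) (closed_twin x y).
Proof.
have [/and3P[/and3P[_ /trivIsetP tiS _] _ _] _] := complete_skeletonP Gamma.
have SA : val A \in twin_classes Gamma.
  by rewrite -complete_skeleton_twin_classes (valP A).
move=> xA yB; rewrite -(mem_twin_classes y SA xA).
apply: (iffP idP) => [yA|->//]; apply/val_inj/eqP; apply: contraLR yA => neqAB.
by rewrite (disjointFl (tiS _ _ (valP A) (valP B) neqAB) yB).
Qed.

End CompleteSkeleton.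

(** The transposition preserves the pair [u], [v] and fixes every pair avoiding both, so only
    adjacency to third vertices imposes a condition. *)
Lemma structurally_equivalentP (G : sgraph) (u v : G) :
  structurally_equivalent u v <->
  forall z, z != u -> z != v -> adj u z = adj v z.
Proof.
split=> [suv z zu zv|uv x y].
  by rewrite -(suv u z) tpermL tpermD // eq_sym.
case: (tpermP u v x) => [->|->|/eqP xu /eqP xv];
  case: (tpermP u v y) => [->|->|/eqP yu /eqP yv];
  rewrite ?adj_irrefl //.
- exact: adj_sym.
- by rewrite uv.
- exact: adj_sym.
- by rewrite uv.
- by rewrite ![adj x _]adj_sym uv.
- by rewrite ![adj x _]adj_sym uv.
Qed.

Lemma skeleton_structure_adj_not_equivalent (Gamma : sgraph)
    (A B : skeleton_structure Gamma) :
  adj A B -> ~ structurally_equivalent A B.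
Proof.
move=> adjAB /structurally_equivalentP eqAB.
have neqAB : A != B by apply: contraTneq adjAB => ->; rewrite adj_irrefl.
have [[a aA] [b bB]] := (part_non_empty A, part_non_empty B).
suff /(part_eqP aA bB)/eqP : closed_twin a b by rewrite (negPf neqAB).
have sS := (complete_skeletonP Gamma).1.
have adj_ab : adj a b by rewrite (adj_part_adj neqAB).
(* If [C] is [A] or [B], then [z] lies in both closed neighbourhoods, as parts are complete and [A],
   [B] are joined. Otherwise [eqAB] at [C] decides. *)
apply/forallP=> z; have [C zC] := exists_part z.
have [eCA|neCA] := eqVneq C A.
  rewrite eCA in zC.
  have /forallP/(_ z) := skeleton_part_twin sS (valP A) zC aA.
  rewrite eqxx /= => /eqP <-.
  by rewrite adj_sym (adj_part_adj neqAB zC bB) adjAB orbT.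
have [eCB|neCB] := eqVneq C B.
  rewrite eCB in zC.
  have /forallP/(_ z) := skeleton_part_twin sS (valP B) zC bB.
  by rewrite eqxx /= => /eqP <-; rewrite (adj_part_adj neqAB aA zC) adjAB orbT.
have neq c D : C != D -> c \in val D -> (z == c) = false.
  move=> neCD cD; apply: contraNF neCD => /eqP ezc; rewrite -ezc in cD.
  by apply/eqP/(part_eqP zC cD)/forallP.
rewrite (neq a A) // (neq b B) //= (@adj_part_adj _ A C) 1?eq_sym //.
by rewrite (@adj_part_adj _ B C) 1?eq_sym // eqAB.
Qed.

Lemma closed_twin_structurally_equivalent (G : sgraph) (u v : G) :
  u != v -> closed_twin u v -> adj u v /\ structurally_equivalent u v.
Proof.
move=> neq_uv tuv; split.
  have /forallP/(_ v)/eqP := tuv.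
  by rewrite eqxx eq_sym (negPf neq_uv).
by apply/structurally_equivalentP=> z; apply: closed_twin_adj.
Qed.

Lemma isomorphic_skeleton_structure (G : sgraph) :
  (forall u v : G, closed_twin u v -> u = v) ->
  isomorphic G (skeleton_structure G).
Proof.
move=> twin_eq.
have [sS _] := complete_skeletonP G.
have valE (A : skeleton_structure G) x : x \in val A -> val A = [set x].
  move=> xA; apply/setP=> y; rewrite inE; apply/idP/eqP=> [yA|-> //].
  exact: twin_eq (skeleton_part_twin sS (valP A) yA xA).
have set1S (x : G) : [set x] \in complete_skeleton G.
  by have [A /valE <-] := exists_part x; apply: valP.
pose f x : skeleton_structure G := Sub [set x] (set1S x).
have fx x : x \in val (f x) by rewrite SubK set11.
have injf : injective f by move=> x y /(congr1 val) /set1_inj.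
exists f => [|x y].
  (* Parts are singletons, so any choice of a vertex in each part inverts [f]. *)
  exists (fun A => sval (part_non_empty A)) => [x|A].
    by case: part_non_empty => y /= /set1P.
  by case: part_non_empty => x xA; apply: val_inj; rewrite /= -(valE A x xA).
have [->|neq_xy] := eqVneq x y; first by rewrite !adj_irrefl.
by rewrite -(adj_part_adj _ (fx x) (fx y)) // (inj_eq injf).
Qed.

Theorem theorem4p4 (G : sgraph) :
  (exists Gamma : sgraph, isomorphic G (skeleton_structure Gamma)) <->
  ~ (exists u v : G, adj u v /\ structurally_equivalent u v).
Proof.
split=> [[Gamma [f [g fK gK] adjf]] [u [v [adj_uv]]]|noG].
  move=> /structurally_equivalentP suv.
  apply: (@skeleton_structure_adj_not_equivalent _ (f u) (f v)).
    by rewrite adjf.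
  (* Writing [C] as [f (g C)] pulls the condition back to the vertex [g C] of [G]. *)
  apply/structurally_equivalentP=> C; rewrite -[C]gK !adjf.
  by rewrite !(inj_eq (can_inj fK)); apply: suv.
exists G; apply: isomorphic_skeleton_structure => u v tuv.
apply/eqP/negPn/negP=> neq_uv; apply: noG; exists u, v.
exact: closed_twin_structurally_equivalent.
Qed.
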